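(* Let $P\in\mathbb{R}^{n\times n}$ and $C\in\mathbb{R}^{m\times n}$ be column-stochastic and let $\mathcal{S}\subset\mathbb{R}^n$ be a finite set of probability vectors. Let $\mathcal{R}=\mathrm{span}\{P^tp_0\mid t\ge0,\ p_0\in\mathcal{S}\}$ and $\mathcal{N}=\{x\in\mathbb{R}^n\mid CP^tx=0\text{ for all }0\le t\le n-1\}$. Let $r_1,\dots,r_N$ be entrywise nonnegative vectors with $\mathrm{span}\{r_1,\dots,r_N\}=\mathcal{R}$ and such that $\bar p:=\frac1N\sum_{i=1}^N r_i$. If $\mathcal{R}\cap\mathcal{N}=\{0\}$, then $\mathscr{A}:=\mathrm{alg}(\bar p^{-1}\wedge\mathcal{R})$ provides the optimal reduction, that is: for every subspace $\mathcal{E}$ with $(\mathcal{R}\cap\mathcal{N})\oplus\mathcal{E}=\mathcal{R}$ and every $p\in\mathbb{R}^n$ with $p_i>0$ for all $i$ such that $e_i\in\mathrm{supp}(\mathcal{E})$, $$\dim\,\mathrm{alg}(\bar p^{-1}\wedge\mathcal{R})\le\dim\,\mathrm{alg}(p^{-1}\wedge\mathcal{E}).$$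
   Context: A matrix is column-stochastic if its entries are nonnegative and each column sums to 1; a probability vector has nonnegative entries summing to 1. $\wedge$ is the entrywise product on $\mathbb{R}^n$. For a vector $v$, $v^{-1}$ denotes the vector with entries $1/v_i$ where $v_i\ne0$ and $0$ where $v_i=0$. For $\mathcal{X}\subseteq\mathbb{R}^n$, $v\wedge\mathcal{X}=\{v\wedge x\mid x\in\mathcal{X}\}$. A subalgebra of $\mathbb{R}^n$ is a linear subspace closed under $\wedge$ (not necessarily containing the all-ones vector); $\mathrm{alg}(\mathcal{X})$ is the smallest subalgebra containing $\mathcal{X}$. With $e_i$ the standard basis vectors, the support of a subspace $\mathcal{V}$ is $\mathrm{supp}(\mathcal{V})=\mathrm{span}\{e_i\mid \exists x\in\mathcal{V}: e_i^Tx\ne0\}$. Meaning of optimality: $(P,C)$ is a Hidden Markov Model with set of initial distributions $\mathcal{S}$. A choice of an effective subspace $\mathcal{E}$ (any complement of $\mathcal{R}\cap\mathcal{N}$ in $\mathcal{R}$) and of a vector $p$ positive on $\mathrm{supp}(\mathcal{E})$ yields a reduced Hidden Markov Model whose dimension is $\dim\,\mathrm{alg}(p^{-1}\wedge\mathcal{E})$; a choice is optimal when this dimension is minimal over all such choices. *)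

(* Defs.v *)
From HB Require Import structures.
From mathcomp Require Import all_boot all_order all_algebra.
From mathcomp Require Import mathcomp_extra boolp classical_sets cardinality.
From mathcomp Require Import reals.

Set Implicit Arguments.
Unset Strict Implicit.
Unset Printing Implicit Defensive.

Import Order.TTheory GRing.Theory Num.Theory.

Local Open Scope classical_set_scope.
Local Open Scope ring_scope.

Section SmallestSubspace.
Variables (F : fieldType) (V : vectType F).
Implicit Types (Q : set {vspace V}) (X : set V).

Lemma bigcapv_subproof Q :
  exists W : {vspace V}, forall x, x \in W <-> (forall U, Q U -> x \in U).
Proof.
suff H k : forall W : {vspace V}, (\dim W <= k)%N ->
    (forall x, (forall U, Q U -> x \in U) -> x \in W) ->
    exists W' : {vspace V}, forall x, x \in W' <-> (forall U, Q U -> x \in U).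
  by apply: (H _ fullv (leqnn _)) => x _; exact: memvf.
elim: k => [|k IHk] W dW QW.
  exists W => x; split=> [xW U _|]; last exact: QW.
  move: dW xW; rewrite leqn0 dimv_eq0 => /eqP->.
  by rewrite memv0 => /eqP->; exact: mem0v.
have [WQ|/existsNP[U /not_implyP[QU /negP nWU]]] :=
  pselect (forall U, Q U -> (W <= U)%VS).
  by exists W => x; split=> [xW U /WQ/subvP|]; [exact|exact: QW].
apply: (IHk (W :&: U)%VS) => [|x Qx]; last by rewrite memv_cap QW //= Qx.
rewrite -ltnS (leq_trans _ dW) // ltn_neqAle dimvS ?capvSl // andbT.
apply: contra nWU => /eqP dWU.
have /eqP <- : (W :&: U)%VS == W by rewrite eqEdim capvSl dWU /=.
exact: capvSr.
Qed.

Definition bigcapv Q : {vspace V} := sval (cid (bigcapv_subproof Q)).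

Lemma bigcapvP Q x : x \in bigcapv Q <-> (forall U, Q U -> x \in U).
Proof. exact: (svalP (cid (bigcapv_subproof Q))). Qed.

(* Linear span of an arbitrary, possibly infinite, set of vectors; the library
   span <<_>> only takes finite sequences. *)
Definition vspan X : {vspace V} := bigcapv [set U | X `<=` [set` U]].

Lemma vspan_seq (s : seq V) : vspan [set` s] = <<s>>%VS.
Proof.
apply/vspaceP => x; apply/idP/idP => [/bigcapvP|xs].
  by apply=> y /= ys; exact: memv_span.
by apply/bigcapvP => U /= sU; have /span_subvP/subvP : {subset s <= U} by []; exact.
Qed.

End SmallestSubspace.

Section EntrywiseAlgebra.
Variables (F : fieldType) (n : nat).
Implicit Types (v x y : 'cV[F]_n) (X : set 'cV[F]_n) (A V : {vspace 'cV[F]_n}).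

Definition wedge x y : 'cV[F]_n := map2_mx *%R x y.

(* In a field 0^-1 = 0, so zero entries stay zero. *)
Definition vinv v : 'cV[F]_n := map_mx GRing.inv v.

Definition wedge_set v X : set 'cV[F]_n := wedge v @` X.

(* The all-ones vector need not belong to A. *)
Definition subalgebra A : Prop :=
  forall x y, x \in A -> y \in A -> wedge x y \in A.

Definition alg X : {vspace 'cV[F]_n} :=
  bigcapv [set A | subalgebra A /\ X `<=` [set` A]].

Lemma alg_subalgebra X : subalgebra (alg X).
Proof.
move=> x y /bigcapvP xX /bigcapvP yX; apply/bigcapvP => A QA.
by apply: (proj1 QA); [exact: xX|exact: yX].
Qed.

Lemma sub_alg X : X `<=` [set` alg X].
Proof. by move=> x Xx; apply/bigcapvP => A [_]; exact. Qed.

Lemma alg_min X A : subalgebra A -> X `<=` [set` A] -> (alg X <= A)%VS.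
Proof. by move=> sA XA; apply/subvP => x /bigcapvP; apply. Qed.

Definition stdbase (i : 'I_n) : 'cV[F]_n := delta_mx i 0.

Definition supp V : {vspace 'cV[F]_n} :=
  vspan [set stdbase i | i in
    [set i | exists2 x, x \in V & (stdbase i)^T *m x != 0]].

End EntrywiseAlgebra.

Section HiddenMarkovModel.
Variables (R : realType) (m n : nat).
Implicit Types (P : 'M[R]_n) (C : 'M[R]_(m, n)) (S : set 'cV[R]_n).

Definition column_stochastic k (A : 'M[R]_(k, n)) : Prop :=
  (forall i j, 0 <= A i j) /\ (forall j, \sum_i A i j = 1).

Definition probability_vector (p : 'cV[R]_n) : Prop :=
  (forall i, 0 <= p i 0) /\ \sum_i p i 0 = 1.

Definition reachable P S : {vspace 'cV[R]_n} :=
  vspan [set x | exists t : nat, exists2 p0, S p0 & x = P ^+ t *m p0].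

Definition nonobservable P C : {vspace 'cV[R]_n} :=
  (\bigcap_(t < n) lker (linfun (mulmx (C *m P ^+ t) : 'cV_n -> 'cV_m)))%VS.

Lemma nonobservableP P C x :
  x \in nonobservable P C <->
  (forall t : nat, (t < n)%N -> C *m P ^+ t *m x = 0).
Proof.
rewrite /nonobservable memvE; split=> [/subv_bigcapP xN t tn|xN].
  by have := xN (Ordinal tn) isT; rewrite -memvE memv_ker lfunE /= => /eqP.
by apply/subv_bigcapP => t _; rewrite -memvE memv_ker lfunE /= xN.
Qed.

End HiddenMarkovModel.

(* Main.v *)
(* Since R meets N trivially, E = R.  Put B = alg(p^-1 /\ R).  The vector
   q = p^-1 /\ pbar lies in B and, the r_i being nonnegative, vanishes exactly
   off the support of R.  A finite-dimensional subalgebra contains the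
   entrywise inverse of each of its elements, so q^-1 lies in B, and
   pbar^-1 /\ x = q^-1 /\ (p^-1 /\ x) shows alg(pbar^-1 /\ R) <= B. *)
Require Import Defs.
From mathcomp Require Import all_boot all_order all_algebra.
From mathcomp Require Import mathcomp_extra boolp classical_sets cardinality.
From mathcomp Require Import reals.

Import Order.TTheory GRing.Theory Num.Theory.

Local Open Scope classical_set_scope.
Local Open Scope ring_scope.

Lemma wedgeE (F : fieldType) (n : nat) (x y : 'cV[F]_n) i :
  wedge x y i 0 = x i 0 * y i 0.
Proof. by rewrite mxE. Qed.

Lemma wedge_diag_mx (F : fieldType) (n : nat) (x y : 'cV[F]_n) :
  wedge x y = diag_mx x^T *m y.
Proof. by apply/colP => i; rewrite mul_diag_mx !mxE. Qed.

(* Multiplication by q is injective, hence onto, on W = q A; so q^2 = q^3 w for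
   some w in W, and w = q^-1. *)
Lemma subalgebra_vinv (F : fieldType) (n : nat) (A : {vspace 'cV[F]_n})
    (q : 'cV[F]_n) :
  subalgebra A -> q \in A -> vinv q \in A.
Proof.
move=> sA qA; pose L := linfun (mulmx (diag_mx q^T) : 'cV_n -> 'cV_n).
have LE z : L z = wedge q z by rewrite lfunE /= wedge_diag_mx.
pose W := (L @: A)%VS.
have WA : (W <= A)%VS.
  by apply/subvP => _ /memv_imgP[z zA ->]; rewrite LE; exact: sA.
(* A field has no nilpotents: in each entry [q * (q * z) = 0] forces [q * z = 0]. *)
have LW0 : (W :&: lker L)%VS = 0%VS.
  apply/eqP; rewrite -subv0; apply/subvP => _ /memv_capP[/memv_imgP[z _ ->]].
  rewrite memv_ker memv0 !LE => /eqP/colP qqz; apply/eqP/colP => i.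
  have /eqP := qqz i; rewrite !wedgeE [in X in _ == X]mxE mulf_eq0 mxE.
  by case/orP => [/eqP->|/eqP //]; rewrite mul0r.
have LW : (L @: W)%VS = W.
  by apply/eqP; rewrite eqEdim limgS //= limg_dim_eq.
(* [W] is the image of [A], so it contains [L q], the square of [q]. Three preimages are taken so
   that cancelling [q] twice leaves [q * w = 1] wherever [q] is nonzero. *)
have : wedge q q \in (L @: (L @: (L @: W)))%VS by rewrite !LW -LE memv_img.
case/memv_imgP => _ /memv_imgP[_ /memv_imgP[w wW ->] ->]; rewrite !LE => /colP q3w.
suff -> : vinv q = w by exact: (subvP WA).
(* Being a multiple of [q], [w] vanishes where [q] does, in agreement with [0^-1 = 0]. *)
have /memv_imgP[z _ wE] := wW; apply/colP => i; rewrite [LHS]mxE.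
have [qi0|qi_neq0] := eqVneq (q i 0) 0.
  by rewrite wE LE wedgeE qi0 invr0 mul0r.
have := q3w i; rewrite !wedgeE => /(mulfI qi_neq0) qE.
apply: (mulfI qi_neq0); apply: (mulfI qi_neq0).
by rewrite -qE mulfV // mulr1.
Qed.

Lemma stdbase_supp (F : fieldType) (n : nat) (V : {vspace 'cV[F]_n})
    (x : 'cV[F]_n) i :
  x \in V -> x i 0 != 0 -> stdbase F i \in supp V.
Proof.
move=> xV xi; apply/bigcapvP => U; apply; exists i => //; exists x => //.
rewrite /stdbase trmx_delta -rowE; apply: contra xi => /eqP/rowP/(_ 0).
by rewrite !mxE => ->.
Qed.

(** Nonnegative terms cannot cancel, so the [i]-th coordinate functional kills every [r k], hence
    their whole span. *)
Lemma memv_span_sum_eq0 (R : numFieldType) (n N : nat) (r : 'I_N -> 'cV[R]_n) i x :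
  (forall k j, 0 <= r k j 0) -> x \in <<codom r>>%VS ->
  (\sum_k r k) i 0 = 0 -> x i 0 = 0.
Proof.
move=> r_ge0 xr; rewrite summxE => /eqP.
rewrite psumr_eq0 // => /allP r0.
suff /subvP/(_ x xr) : (<<codom r>> <= lker (linfun (mulmx (delta_mx 0%R i) :
    'cV[R]_n -> 'cV[R]_1)))%VS.
  by rewrite memv_ker lfunE /= -rowE => /eqP/colP/(_ 0); rewrite !mxE.
apply/span_subvP => _ /codomP[k ->]; rewrite memv_ker lfunE /= -rowE.
apply/eqP/colP => j; rewrite ord1 !mxE; apply/eqP.
by apply: r0; rewrite mem_index_enum.
Qed.

Theorem proposition4 (R : realType) (m n : nat)
    (P : 'M[R]_n) (C : 'M[R]_(m, n)) (S : set 'cV[R]_n)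
    (stochP : column_stochastic P) (stochC : column_stochastic C)
    (finS : finite_set S) (probS : forall p0, S p0 -> probability_vector p0)
    (N : nat) (N_gt0 : (0 < N)%N) (r : 'I_N -> 'cV[R]_n)
    (r_ge0 : forall i j, 0 <= r i j 0)
    (span_r : <<codom r>>%VS = reachable P S)
    (pbar : 'cV[R]_n) (pbarE : pbar = N%:R^-1 *: \sum_(i < N) r i)
    (RN0 : (reachable P S :&: nonobservable P C = 0)%VS) :
  forall (E : {vspace 'cV[R]_n}) (p : 'cV[R]_n),
    directv ((reachable P S :&: nonobservable P C) + E)%VS ->
    ((reachable P S :&: nonobservable P C) + E)%VS = reachable P S ->
    (forall i : 'I_n, stdbase R i \in supp E -> 0 < p i 0) ->
    (\dim (alg (wedge_set (vinv pbar) [set` reachable P S]))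
       <= \dim (alg (wedge_set (vinv p) [set` E])))%N.
Proof.
move=> E p _; rewrite RN0 add0v => -> p_gt0.
set V := reachable P S in span_r p_gt0 *; set B := alg (wedge_set (vinv p) _).
have memB x : x \in V -> wedge (vinv p) x \in B.
  by move=> xV; apply: sub_alg; exists x.
have pbarV : pbar \in V.
  rewrite pbarE memvZ // memv_suml // => k _.
  by rewrite -span_r memv_span ?codom_f.
apply/dimvS/alg_min; first exact: alg_subalgebra.
move=> _ [x /= xV <-].
suff -> : wedge (vinv pbar) x =
    wedge (vinv (wedge (vinv p) pbar)) (wedge (vinv p) x).
  apply: alg_subalgebra; last exact: memB.
  by apply: subalgebra_vinv; [exact: alg_subalgebra|exact: memB].
apply/colP => i; rewrite !mxE.
(* Where [pbar] vanishes, so does every reachable [x], and both sides are zero. *)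
have [pi0|pi_neq0] := eqVneq (pbar i 0) 0.
  rewrite (memv_span_sum_eq0 _ _ _ r i x r_ge0) ?span_r ?mulr0 //.
  have /eqP := pi0; rewrite pbarE mxE mulf_eq0 invr_eq0 pnatr_eq0.
  by rewrite eqn0Ngt N_gt0 => /eqP.
(* Here [pbar] itself witnesses that the [i]-th basis vector lies in the support, so [p i 0] is
   positive and cancels. *)
have pi : p i 0 != 0 by rewrite gt_eqF // p_gt0 // (stdbase_supp _ _ _ _ _ pbarV).
by rewrite invfM invrK mulrA (mulrAC (p i 0)) divff // mul1r.
Qed.
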